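(* Let $\Sigma$ be a set of symbols, $\mathcal D\subset\Sigma^*\times\Sigma^*$ a finite domino set, and $f:\Sigma^*\to\mathbb{R}_+$ a norm function. Assume that $\sup_{\gamma\in\mathcal T(\mathcal D)}\mathrm{dens}_f(\gamma)\in(0,\infty)$. Then there exists a periodic linear domino tiling $\gamma\in\mathcal T(\mathcal D)$, with period at most $\#\mathcal D$, such that $\mathrm{dens}_f(\gamma)=\sup_{\alpha\in\mathcal T(\mathcal D)}\mathrm{dens}_f(\alpha)$.
   Context: $\Sigma^*$ is the set of finite words over $\Sigma$ (including the empty word), $\#w$ the length, and $uv$ concatenation. $\mathcal T(\mathcal D)$ is the set of infinite words $\gamma=w_1w_2w_3\dots$ with $w_i\in\Sigma^*$ and $(w_i,w_{i+1})\in\mathcal D$ for all $i$; it is periodic with period $n$ if $w_{i+n}=w_i$ for all $i$. A norm function $f:\Sigma^*\to\mathbb{R}_+$ satisfies: (a) for any $w_1,w_2,w_3\in\Sigma^*$, $k\ge0\mapsto\#(w_1w_2^kw_3)/f(w_1w_2^kw_3)$ is monotone; (b) $k>0\mapsto\#(w_2^k)/f(w_2^k)$ is a positive constant; (c) for any $\epsilon>0$ there is $\delta>0$ such that if $w'$ is a subword of $w$ with $\#w-\#w'\le\epsilon$ then $|f(w)-f(w')|\le\delta$. For $\gamma=w_1w_2\dots\in\mathcal T(\mathcal D)$, $\mathrm{dens}_f(\gamma)=\limsup_{t\to\infty}\#(w_1\dots w_t)/f(w_1\dots w_t)$. *)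

(* Defs.v *)
From HB Require Import structures.
From mathcomp Require Import all_boot all_order all_algebra.
From mathcomp Require Import finmap.
From mathcomp Require Import all_classical all_reals all_analysis.

Set Implicit Arguments.
Unset Strict Implicit.
Unset Printing Implicit Defensive.

Import Order.TTheory GRing.Theory Num.Theory.

Local Open Scope ring_scope.
Local Open Scope classical_set_scope.

Definition word_pow (T : Type) (w : seq T) (k : nat) : seq T :=
  flatten (nseq k w).

(* With [x / 0 = 0], the value is 0 at the empty word, whatever [f [::]] is. *)
Definition size_ratio (R : realType) (T : Type) (f : seq T -> R) (w : seq T) : R :=
  (size w)%:R / f w.

(* In (b), [w] is nonempty: for the empty word the ratio is 0 / f [::], which
   is never positive.  In (a), whether the sequence is nondecreasing or
   nonincreasing may depend on the three words.  In (c), "subword" means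
   contiguous factor, so (c) constrains the fewest pairs of words. *)
Record norm_function (R : realType) (T : eqType) (f : seq T -> R) : Prop :=
  NormFunction {
    norm_ge0 : forall w, 0 <= f w;
    norm_monotone : forall w1 w2 w3,
      let u := fun k : nat => size_ratio f (w1 ++ word_pow w2 k ++ w3) in
      nondecreasing_seq u \/ nonincreasing_seq u;
    norm_power : forall w, w != [::] ->
      exists2 c : R, 0 < c &
        forall k : nat, (0 < k)%N -> size_ratio f (word_pow w k) = c;
    norm_subword : forall eps : R, 0 < eps ->
      exists2 delta : R, 0 < delta &
        forall w' w, infix w' w -> (size w)%:R - (size w')%:R <= eps ->
          `|f w - f w'| <= delta
  }.

(* The word w_1 ... w_t; tilings are indexed from 0, so w_i is [g i.-1]. *)
Definition tiling_prefix (T : Type) (g : nat -> seq T) (t : nat) : seq T :=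
  flatten (mkseq g t).

(* A tiling is the sequence of its blocks.  Blocks may be empty, and the second
   condition says that their concatenation really is an infinite word. *)
Definition linear_tilings (T : choiceType)
    (D : {fset (seq T * seq T)%type}) : set (nat -> seq T) :=
  [set g | (forall i, (g i, g i.+1) \in D) /\
           (forall m, exists t, (m <= size (tiling_prefix g t))%N)].

Definition has_period (T : Type) (g : nat -> seq T) (n : nat) : Prop :=
  forall i, g (i + n)%N = g i.

Definition density (R : realType) (T : Type) (f : seq T -> R)
    (g : nat -> seq T) : \bar R :=
  limn_esup (fun t => (size_ratio f (tiling_prefix g t))%:E).

Definition max_density (R : realType) (T : choiceType) (f : seq T -> R)
    (D : {fset (seq T * seq T)%type}) : \bar R :=
  ereal_sup [set density f g | g in linear_tilings D].

(* Main.v *)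
(* Removing a closed sub-walk y from a walk xyz either does not decrease the
   ratio #/f, or, by (a), pumping y does not decrease it; in the second case the
   limit, by (b) and (c), is the ratio of y itself.  Hence the ratio of every
   closed walk is at most the largest ratio C of a simple cycle.  A prefix of a
   tiling is a closed walk preceded by a prefix of bounded size, so by (c) every
   tiling has density at most C, and C is attained by repeating a best simple
   cycle, whose length is at most the number of dominoes. *)
Require Import Defs.
From mathcomp Require Import all_boot all_order all_algebra.
From mathcomp Require Import finmap.
From mathcomp Require Import all_classical all_reals all_analysis.
From mathcomp Require Import lra zify.

Set Implicit Arguments.
Unset Strict Implicit.
Unset Printing Implicit Defensive.

Import Order.TTheory GRing.Theory Num.Theory.

Local Open Scope ring_scope.

Lemma archimedean_le0 (R : realType) (a b : R) :
  (forall k : nat, k%:R * a <= b) -> a <= 0.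
Proof.
move=> H; rewrite leNgt; apply/negP => a0.
have [k hk] : exists k : nat, b / a < k%:R.
  by exists (Num.bound `|b / a|); apply: le_lt_trans (archi_boundP _); rewrite ?ler_norm.
by have := H k; rewrite leNgt -ltr_pdivrMr // hk.
Qed.

(** * Norm functions and the insertion of a factor *)

Section NormFunction.
Variables (R : realType) (T : eqType) (f : seq T -> R).
Hypothesis hf : norm_function f.

Lemma size_ratio_ge0 w : 0 <= size_ratio f w.
Proof. by rewrite divr_ge0 ?(norm_ge0 hf). Qed.

Lemma size_word_pow (w : seq T) k : size (word_pow w k) = (k * size w)%N.
Proof. by elim: k => //= k IH; rewrite size_cat -/(word_pow w k) IH mulSn. Qed.

Lemma word_pow1 (w : seq T) : word_pow w 1 = w.
Proof. exact: cats0. Qed.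

Lemma norm_gt0 w : w != [::] -> 0 < f w.
Proof.
move=> w0; rewrite lt_neqAle (norm_ge0 hf) andbT; apply/negP => /eqP fw.
have [c c0 /(_ 1%N isT)] := norm_power hf w0.
by rewrite word_pow1 /size_ratio -fw invr0 mulr0 => ce; rewrite ce ltxx in c0.
Qed.

Lemma size_ratio_gt0 w : w != [::] -> 0 < size_ratio f w.
Proof. by move=> w0; rewrite divr_gt0 ?norm_gt0// ltr0n lt0n size_eq0. Qed.

Lemma size_ratio_pow w k : w != [::] -> (0 < k)%N ->
  size_ratio f (word_pow w k) = size_ratio f w.
Proof.
move=> w0 k0; have [c _ H] := norm_power hf w0.
by rewrite H // -(H 1%N) // word_pow1.
Qed.

Lemma size_ratio_le_mul w r : size_ratio f w <= r -> (size w)%:R <= r * f w.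
Proof.
have [->|w0] := eqVneq w [::].
  by rewrite /size_ratio /= mul0r => r0; rewrite mulr_ge0 ?(norm_ge0 hf).
by rewrite /size_ratio ler_pdivrMr ?norm_gt0.
Qed.

Lemma size_ratio_ge_mul w r : 0 <= r -> r <= size_ratio f w ->
  r * f w <= (size w)%:R.
Proof.
have [->|w0] := eqVneq w [::]; last by rewrite /size_ratio ler_pdivlMr ?norm_gt0.
rewrite /size_ratio /= mul0r => r0 r0'.
have -> : r = 0 by apply/eqP; rewrite eq_le r0' r0.
by rewrite mul0r.
Qed.

(** In the nonincreasing case compare the exponents 0 and 1 of [w]. In the nondecreasing case every
    pumped word has ratio at least [r], while its ends have fixed size, which forces [r <= c]. *)
Lemma size_ratio_insert a w b :
  size_ratio f (a ++ w ++ b) <=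
    Num.max (size_ratio f (a ++ b)) (size_ratio f w).
Proof.
have [->|w0] := eqVneq w [::]; first by rewrite le_max lexx.
rewrite le_max; apply/orP.
have [up|down] := norm_monotone hf a w b; last first.
  by left; have := down 0%N 1%N isT; rewrite word_pow1.
right.
set r := size_ratio f (a ++ w ++ b).
have pump k : (0 < k)%N -> r <= size_ratio f (a ++ word_pow w k ++ b).
  by move=> k0; have := up 1%N k k0; rewrite word_pow1.
have c0 := size_ratio_gt0 w0; set c := size_ratio f w in c0 *.
have r0 : 0 <= r by exact: size_ratio_ge0.
pose A : R := (size a + size b)%:R.
have [delta d0 fD] := norm_subword hf (ltr_wpDl (ler0n R (size a + size b)) ltr01).
rewrite -/A in fD.
(* The right side does not depend on [k], so [r - c] cannot be positive. *)
have key k : k.+1%:R * ((size w)%:R * (r - c)) <= c * (A + r * delta).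
  have h := size_ratio_ge_mul r0 (pump k.+1 isT).
  have sE : (size (a ++ word_pow w k.+1 ++ b))%:R = k.+1%:R * (size w)%:R + A :> R.
    by rewrite !size_cat size_word_pow -natrM -natrD addnCA.
  have := fD (word_pow w k.+1) (a ++ word_pow w k.+1 ++ b) (infix_infix _ _ _).
  rewrite sE size_word_pow natrM => /(_ ltac:(lra)).
  rewrite ler_norml => /andP[lo _].
  have sp : k.+1%:R * (size w)%:R <= c * f (word_pow w k.+1).
    by rewrite -natrM -size_word_pow size_ratio_le_mul // size_ratio_pow.
  rewrite sE in h; move: (f _) (f _) h lo sp => y x h lo sp.
  (* Here [x] is the norm of the pumped word and [y] that of the power of [w]. With [K = k.+1] and
     [n = size w], the chain is [r K n <= r c y <= c r (x + delta) <= c (K n + A + r delta)]. *)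
  have ry : r * y <= r * (x + delta) by apply: (ler_wpM2l r0); lra.
  have cry := ler_wpM2l (ltW c0) ry.
  have ch := ler_wpM2l (ltW c0) h.
  have rs := ler_wpM2l r0 sp.
  move: (k.+1%:R) (size w)%:R rs ch cry => K n rs ch cry; clearbody r c A.
  nra.
have : (size w)%:R * (r - c) <= 0.
  apply: (@archimedean_le0 _ _ (c * (A + r * delta))) => -[|k]; last exact: key.
  by rewrite mul0r mulr_ge0 ?(ltW c0) // addr_ge0 ?ler0n// mulr_ge0 ?(ltW d0).
by rewrite pmulr_rle0 ?subr_le0// ltr0n lt0n size_eq0.
Qed.

End NormFunction.

(** * Splitting closed walks, and first visits *)

Lemma not_uniq_split (T : eqType) (s : seq T) :
  ~~ uniq s -> exists x v y z, s = x ++ v :: y ++ v :: z.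
Proof.
elim: s => //= a s IH; rewrite negb_and negbK => /orP[/splitPr[y z]|/IH].
  by exists [::], a, y, z.
by move=> [x [v [y [z ->]]]]; exists (a :: x), v, y, z.
Qed.

(** After rotation the walk starts at [v], and each of the two pieces returns to [v]. *)
Lemma cycle_splice (T : Type) (e : rel T) (x y z : seq T) (v : T) :
  cycle e (x ++ v :: y ++ v :: z) -> cycle e (v :: y) && cycle e (x ++ v :: z).
Proof.
rewrite !(cycle_catC e x) /= -!catA /= !rcons_cat !cat_path /= !rcons_path.
by rewrite cat_path last_cat => /and4P[-> -> /andP[-> ->] ->].
Qed.

(** [S] is the largest of the finitely many first visit times; what matters is that it does not
    depend on [t]. *)
Lemma first_visits_bounded (T : choiceType) (g : nat -> T) (V : seq T) :
  exists S, forall t, g t \in V -> exists s, [/\ (s <= S)%N, (s <= t)%N & g s = g t].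
Proof.
elim: V => [|v V [S IH]]; first by exists 0%N.
have [/asboolP ex|nex] := boolP `[< exists s, g s == v >]; last first.
  exists S => t; rewrite inE => /predU1P[gt|]; last exact: IH.
  by case/asboolP: nex; exists t; apply/eqP.
case: (ex_minnP ex) => s0 /eqP gs0 min0.
exists (maxn s0 S) => t; rewrite inE => /predU1P[gt|/IH[s [sS st gst]]].
  exists s0; split; rewrite ?leq_maxl ?gs0 //; apply: min0; exact/eqP.
by exists s; split=> //; rewrite leq_max sS orbT.
Qed.

Lemma limn_esup_le (R : realType) (u : nat -> R) (c : R) :
  (forall e, 0 < e -> exists N, forall t, (N <= t)%N -> u t <= c + e) ->
  (limn_esup (fun t => (u t)%:E) <= c%:E)%E.
Proof.
move=> H; apply/lee_addgt0Pr => e /H[N HN].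
rewrite /limn_esup /limf_esup; apply: ge_ereal_inf.
exists (ereal_sup ((fun t => (u t)%:E) @` [set t | (N <= t)%N])%classic).
  by exists [set t | (N <= t)%N]%classic => //; exists N.
by apply: ge_ereal_sup => _ [t /= Nt <-]; rewrite -EFinD lee_fin HN.
Qed.

Lemma limn_esup_ge (R : realType) (u : nat -> R) (c : R) :
  (forall N, exists2 t, (N <= t)%N & c <= u t) ->
  (c%:E <= limn_esup (fun t => (u t)%:E))%E.
Proof.
move=> H; rewrite /limn_esup /limf_esup.
apply: le_ereal_inf_tmp => _ [V [N _ NV] <-].
have [t Nt cu] := H N.
apply: (le_trans (y := (u t)%:E)); first by rewrite lee_fin.
by apply: ereal_sup_ubound; exists t => //; exact: NV.
Qed.

(** * Closed walks in the digraph of dominoes *)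

Section Tilings.
Variables (R : realType) (T : choiceType) (f : seq T -> R).
Variable D : {fset (seq T * seq T)%type}.
Hypothesis hf : norm_function f.

Let domino : rel (seq T) := fun w w' => (w, w') \in D.

(** Left components suffice, since each block of a closed walk has a successor. Repetitions are
    kept, so the length is exactly the number of dominoes. *)
Let blocks : seq (seq T) := map fst D.

Lemma cycle_blocks s : cycle domino s -> {subset s <= blocks}.
Proof.
move=> cs w /(next_cycle cs) wD.
by apply/mapP; exists (w, next s w).
Qed.

Lemma size_ucycle s : ucycle domino s -> (size s <= #|` D|)%N.
Proof.
move=> /andP[cs us]; rewrite -(size_map fst D).
exact: uniq_leq_size (cycle_blocks cs).
Qed.

(** Strong induction on the number of blocks: a repeated block splits the walk into two shorter
    closed walks, one inserted into the other. *)
Lemma cycle_ratio_le (c : R) :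
  (forall s, ucycle domino s -> size_ratio f (flatten s) <= c) ->
  forall s, cycle domino s -> size_ratio f (flatten s) <= c.
Proof.
move=> H s; have [n] := ubnP (size s); elim: n s => // n IH s sn cs.
have [us|/not_uniq_split[x [v [y [z sE]]]]] := boolP (uniq s).
  by apply: H; rewrite /ucycle cs.
move: sn cs; rewrite sE => sn cs; have /andP[cy cxz] := cycle_splice cs.
have -> : flatten (x ++ v :: y ++ v :: z) =
    flatten x ++ flatten (v :: y) ++ flatten (v :: z).
  by rewrite -!flatten_cat.
apply: le_trans (size_ratio_insert hf _ _ _) _.
by rewrite -flatten_cat ge_max !IH //;
  move: sn; rewrite /= !size_cat /= size_cat /=; lia.
Qed.

Lemma exists_max_ucycle : exists2 s0, ucycle domino s0 &
  forall s, cycle domino s ->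
    size_ratio f (flatten s) <= size_ratio f (flatten s0).
Proof.
pose I := (#|` D|).-bseq (seq_sub blocks).
pose F (b : I) := size_ratio f (flatten (map val b)).
pose P (b : I) := ucycleb domino (map val b).
(* The empty cycle, of ratio 0, guarantees that the finite set of candidates is inhabited. *)
have P0 : P [bseq] by [].
have [b Pb maxb] := Order.TotalTheory.arg_maxP F P0.
exists (map val b) => //; apply: cycle_ratio_le => s us.
have /andP[cs _] := us.
have sE : map val (pmap (insub : seq T -> option (seq_sub blocks)) s) = s.
  rewrite (pmap_filter (insubK _)); apply/all_filterP/allP => w ws.
  by rewrite isSome_insub (cycle_blocks cs).
have sz : (size (pmap (insub : seq T -> option (seq_sub blocks)) s) <= #|` D|)%N.
  by rewrite -(size_map val) sE size_ucycle.
have := maxb (Bseq sz); rewrite /P /F /= sE; exact.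
Qed.

(** Let [s] be a time at most [S] with [g s = g t]. The blocks from [s] to [t - 1] form a closed
    walk, because the successor of the last one is [g t]. *)
Lemma tiling_prefix_cycle g : (forall i, domino (g i) (g i.+1)) ->
  exists S, forall t, exists s q,
    [/\ (s <= S)%N, tiling_prefix g t = tiling_prefix g s ++ flatten q &
        cycle domino q].
Proof.
move=> gD; have [S HS] := first_visits_bounded g blocks.
exists S => t; have [|s [sS st gst]] := HS t.
  by apply/mapP; exists (g t, g t.+1) => //; exact: gD.
exists s, (map g (iota s (t - s))); split=> //.
  by rewrite /tiling_prefix /mkseq -flatten_cat -map_cat -iotaD subnKC.
case: (ltngtP s t) st => // [st _|-> _]; last by rewrite subnn.
have walk m n : path domino (g m) (map g (iota m.+1 n)).
  by elim: n m => //= n IH m; rewrite gD IH.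
have [k tE] : exists k, (t - s = k.+1)%N by exists (t - s).-1; lia.
have stE : t = (s.+1 + k)%N by lia.
rewrite tE /= {2}gst stE -map_rcons -cats1 -(iotaD s.+1 k 1) addn1.
exact: walk.
Qed.

Lemma tiling_density_le g c : 0 < c ->
  (forall q, cycle domino q -> size_ratio f (flatten q) <= c) ->
  linear_tilings D g -> (density f g <= c%:E)%E.
Proof.
move=> c0 H [gD ginf]; apply: limn_esup_le => e e0.
have [S HS] := tiling_prefix_cycle gD.
pose A : R := (size (tiling_prefix g S))%:R.
have [delta d0 fD] := norm_subword hf (ltr_wpDl (ler0n R _ : 0 <= A) ltr01).
have ps s t : (s <= t)%N -> (size (tiling_prefix g s) <= size (tiling_prefix g t))%N.
  move=> st; rewrite /tiling_prefix /mkseq -(subnKC st) iotaD map_cat flatten_cat.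
  by rewrite size_cat leq_addr.
pose B := A + c * delta.
have B0 : 0 <= B by rewrite addr_ge0 ?ler0n // mulr_ge0 ?ltW.
(* It will be shown that [size p <= B + c * f p]. Once [size p] is at least [B * (c + e) / e], this
   gives [size p <= (c + e) * f p]. The successor makes [p] nonempty. *)
have [N hN] := ginf (Num.bound (B * (c + e) / e)).+1.
exists N => t Nt.
have [s [q [sS tE cq]]] := HS t.
set p := tiling_prefix g t in tE *.
have pB : B * (c + e) <= (size p)%:R * e.
  rewrite -ler_pdivrMr //; apply/ltW/(lt_le_trans (archi_boundP _)).
    exact: divr_ge0 (mulr_ge0 B0 (ltW (addr_gt0 c0 e0))) (ltW e0).
  by rewrite ler_nat; exact: ltnW (leq_trans hN (ps _ _ Nt)).
have p0 : p != [::].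
  by rewrite -size_eq0 -lt0n (leq_trans _ (leq_trans hN (ps _ _ Nt))).
rewrite /size_ratio ler_pdivrMr ?(norm_gt0 hf) //.
have szp : (size p)%:R <= A + (size (flatten q))%:R :> R.
  by rewrite tE size_cat natrD lerD2r ler_nat ps.
have qc := size_ratio_le_mul hf (H _ cq).
have qp : infix (flatten q) p.
  by rewrite tE -[X in infix _ (_ ++ X)]cats0 infix_infix.
have := fD _ _ qp ltac:(lra); rewrite ler_norml => /andP[lo _].
have pf : (size p)%:R <= B + c * f p.
  have := ler_wpM2l (ltW c0) (_ : f (flatten q) <= f p + delta); rewrite /B; lra.
have c1 : (size p)%:R * (c + e) <= B * (c + e) + c * f p * (c + e).
  by rewrite -mulrDl ler_wpM2r // addr_ge0 ?ltW.
rewrite -(ler_pM2l c0); lra.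
Qed.

(** Blocks may be empty, so this needs a prefix longer than every prefix of at most [S] blocks: its
    closed part then carries a letter. *)
Lemma exists_nonempty_cycle g : linear_tilings D g ->
  exists2 q, cycle domino q & flatten q != [::].
Proof.
move=> [gD ginf]; have [S HS] := tiling_prefix_cycle gD.
have [t ht] := ginf (\max_(s < S.+1) size (tiling_prefix g s)).+1.
have [s [q [sS tE cq]]] := HS t; exists q => //.
apply/negP => /eqP q0; move: ht; rewrite tE q0 cats0 ltnNge.
by rewrite (leq_bigmax (Ordinal (sS : s < S.+1)%N)).
Qed.

(** * Tilings that repeat a closed walk *)

Definition periodic_tiling (s : seq (seq T)) (i : nat) : seq T :=
  nth [::] s (i %% size s).

Lemma tiling_prefix_periodic s k :
  tiling_prefix (periodic_tiling s) (k * size s) = word_pow (flatten s) k.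
Proof.
have [->|s0] := eqVneq s [::].
  by rewrite muln0 /word_pow; elim: k.
rewrite /tiling_prefix /mkseq; elim: k => // k IH.
rewrite mulSn addnC iotaD map_cat flatten_cat IH add0n.
have -> : [seq periodic_tiling s i | i <- iota (k * size s) (size s)] = s.
  apply: (@eq_from_nth _ [::]); rewrite size_map size_iota // => i lt_i.
  by rewrite (nth_map 0%N) ?size_iota // nth_iota // /periodic_tiling modnMDl modn_small.
by rewrite /word_pow -(addn1 k) nseqD flatten_cat /= cats0.
Qed.

Lemma periodic_tilingP s : cycle domino s -> flatten s != [::] ->
  linear_tilings D (periodic_tiling s).
Proof.
move=> cs fs0.
have s0 : (0 < size s)%N by case: (s) fs0.
split=> [i|m].
  case: s cs s0 {fs0} => // w s /(pathP [::]) cs s0.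
  have lt_i : (i %% size (w :: s) < size (w :: s))%N by rewrite ltn_mod.
  have := cs (i %% size (w :: s))%N; rewrite size_rcons => /(_ lt_i).
  rewrite -rcons_cons /periodic_tiling nth_rcons lt_i.
  rewrite nth_rcons -(addn1 i) -modnDml addn1 /domino.
  (* At the last block the next index wraps around to 0, and [rcons] supplies the first block. *)
  move: lt_i; rewrite ltnS leq_eqVlt => /predU1P[->|lt_i].
    by rewrite ltnn eqxx modnn; exact: id.
  by rewrite lt_i (@modn_small (i %% _).+1) ?ltnS //; exact: id.
exists (m * size s)%N; rewrite tiling_prefix_periodic size_word_pow.
by rewrite leq_pmulr // lt0n size_eq0.
Qed.

End Tilings.

Theorem theorem4p2 (R : realType) (Sigma : choiceType)
    (D : {fset (seq Sigma * seq Sigma)%type}) (f : seq Sigma -> R)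
    (hf : norm_function f)
    (hpos : (0 < max_density f D)%E) (hfin : (max_density f D < +oo)%E) :
  exists (g : nat -> seq Sigma) (n : nat),
    [/\ linear_tilings D g, (0 < n <= #|` D|)%N, has_period g n &
        density f g = max_density f D].
Proof.
have [s us maxs] := exists_max_ucycle D hf.
have /andP[cs _] := us.
(* Over an empty set the supremum would be [-oo], against positivity. *)
have [a Da] : exists a, linear_tilings D a.
  apply: contrapT => nex; move: hpos; rewrite /max_density.
  rewrite (_ : [set _ | _ in _]%classic = set0) ?ereal_sup0 //.
  by rewrite -subset0 => y [a Da]; case: nex; exists a.
have [q cq q0] := exists_nonempty_cycle Da.
set c := size_ratio f (flatten s) in maxs.
(* This also excludes that the best cycle spells the empty word. *)
have c0 : 0 < c := lt_le_trans (size_ratio_gt0 hf q0) (maxs _ cq).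
have s0 : flatten s != [::].
  by apply/eqP => sE; move: c0; rewrite /c sE /size_ratio mul0r ltxx.
have sz0 : (0 < size s)%N by case: (s) s0.
exists (periodic_tiling s), (size s); split.
- exact: periodic_tilingP.
- by rewrite sz0 (size_ucycle us).
- by move=> i; rewrite /periodic_tiling modnDr.
have sup_le : (max_density f D <= c%:E)%E.
  by apply: ge_ereal_sup => _ [b Db <-]; apply: tiling_density_le Db.
apply/eqP; rewrite eq_le; apply/andP; split.
  by apply: ereal_sup_ubound; exists (periodic_tiling s) => //; exact: periodic_tilingP.
apply: le_trans sup_le _; apply: limn_esup_ge => N.
(* After whole periods the ratio is exactly [c]; [N.+1] keeps the exponent positive, as (b)
   requires. *)
exists (N.+1 * size s)%N; first by rewrite (leq_trans (leqnSn N)) ?leq_pmulr.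
by rewrite tiling_prefix_periodic (size_ratio_pow hf s0).
Qed.
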